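(* Let $n\ge1$ and let $c=\{c_{ij}\}$ be a set of real numbers indexed by the diagonals of an $(n+3)$-gon. The polytope $$\mathcal{F}_c^\emptyset=\{x\in\mathcal{A}_{A_n}(\mathbb{R}^t) : A_{ij}^t(x)\le c_{ij}\text{ for all diagonals }\{ij\}\}$$ is a Stasheff polytope if and only if $$c_{ij}+c_{kl}\ge\max\{c_{ik}+c_{jl},\,c_{kj}+c_{il}\}\quad\text{for all } i,k,j,l\text{ seated clockwise}.$$ Furthermore, $\mathcal{F}_c^\emptyset$ is non-degenerate if and only if these inequalities are strict for all $i,k,j,l$ seated clockwise. (Here $c_{pq}=0$ if $\{pq\}$ is an edge.)
   Context: Fix an $(n+3)$-gon with vertices labeled $1,\dots,n+3$ clockwise. A segment $\{ij\}$ joins two distinct vertices; it is an edge if they are adjacent and a diagonal otherwise. A partial triangulation is a (possibly empty) set of pairwise non-crossing diagonals; it is complete if maximal. ''$i,k,j,l$ seated clockwise'' means four distinct vertices occurring in this cyclic clockwise order. A point $x\in\mathcal{A}_{A_n}(\mathbb{R}^t)$ (a real tropical point of the cluster $\mathcal{A}$-variety of type $A_n$) is a collection of real numbers $A_{pq}^t(x)$, one for each segment, with $A_{pq}^t(x)=0$ for edges and $A_{pr}^t(x)+A_{qs}^t(x)=\max\{A_{pq}^t(x)+A_{rs}^t(x),A_{qr}^t(x)+A_{ps}^t(x)\}$ whenever $p,q,r,s$ are seated clockwise; for each complete triangulation $T$ the values on $T$ give a bijection (coordinate system) $\mathcal{A}_{A_n}(\mathbb{R}^t)\simeq\mathbb{R}^n$.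 For a partial triangulation $T$, let $S(T)$ be the set of diagonals not in $T$ crossing no element of $T$, and $\mathcal{F}_c^T=\{x\in\mathcal{A}_{A_n}(\mathbb{R}^t) : A_{ij}^t(x)=c_{ij}\ \forall\{ij\}\in T,\ A_{ij}^t(x)\le c_{ij}\ \forall\{ij\}\in S(T)\}$. $\mathcal{F}_c^\emptyset$ is a Stasheff polytope if $T_1\subseteq T_2$ implies $\mathcal{F}_c^{T_2}\subseteq\mathcal{F}_c^{T_1}$ for all partial triangulations $T_1,T_2$. For each $T$, in a coordinate system given by a complete triangulation containing $T$, $\mathcal{F}_c^T$ is a convex polytope of dimension at most $n-\#T$; $\mathcal{F}_c^\emptyset$ is called non-degenerate if $\dim\mathcal{F}_c^T=n-\#T$ for every partial triangulation $T$. *)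

(* Defs.v *)
From mathcomp Require Import all_boot all_order all_algebra.
From mathcomp Require Import boolp classical_sets reals.

Set Implicit Arguments.
Unset Strict Implicit.
Unset Printing Implicit Defensive.

Import Order.TTheory GRing.Theory Num.Theory.

Section Polygon.
Variable n : nat.

(* The vertices of the (n+3)-gon are 0, ..., n+2, in clockwise order. *)
Local Notation vertex := 'I_n.+3.

Definition adjacent (i j : vertex) : bool := (j == ordS i) || (i == ordS j).

(* A segment is the set of its two endpoints. *)
Definition is_diagonal (s : {set vertex}) : bool :=
  [exists i : vertex, exists j : vertex,
     [&& i != j, ~~ adjacent i j & s == [set i; j]]].

Definition gon_diagonal : Type := {s : {set vertex} | is_diagonal s}.

Definition increasing (p q r s : vertex) : bool := [&& p < q, q < r & r < s].

Definition clockwise (p q r s : vertex) : bool :=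
  [|| increasing p q r s, increasing q r s p,
      increasing r s p q | increasing s p q r].

Definition crosses (d e : gon_diagonal) : bool :=
  [exists p : vertex, exists q : vertex, exists r : vertex, exists s : vertex,
     [&& clockwise p q r s, val d == [set p; r] & val e == [set q; s]]].

Definition partial_triangulation (T : {set gon_diagonal}) : bool :=
  [forall d in T, forall e in T, ~~ crosses d e].

Definition complete_triangulation (T : {set gon_diagonal}) : bool :=
  maxset partial_triangulation T.

(* S(T) *)
Definition compatible_diagonals (T : {set gon_diagonal}) :
    {set gon_diagonal} :=
  [set d | (d \notin T) && [forall e in T, ~~ crosses d e]].

End Polygon.

Local Open Scope classical_set_scope.
Local Open Scope ring_scope.

(* The value on the segment {pq} of a family indexed by diagonals, extended by
   zero to the edges. It serves both for the c_{pq} and for the A_{pq}^t(x). *)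
Definition seg_val (R : realType) (n : nat) (f : gon_diagonal n -> R)
    (p q : 'I_n.+3) : R :=
  oapp f 0 (insub [set p; q]%SET).

(* Since A_{pq}^t vanishes on edges, a point of A_{A_n}(R^t) is given by its
   values on the diagonals. *)
Definition tropical_points (R : realType) (n : nat) :
    set (gon_diagonal n -> R) :=
  [set A | forall p q r s : 'I_n.+3, clockwise p q r s ->
     seg_val A p r + seg_val A q s =
     Num.max (seg_val A p q + seg_val A r s) (seg_val A q r + seg_val A p s)].

(* F_c^T *)
Definition face (R : realType) (n : nat) (c : gon_diagonal n -> R)
    (T : {set gon_diagonal n}) : set (gon_diagonal n -> R) :=
  [set A | [/\ tropical_points A,
               forall d, d \in T -> A d = c d &
               forall d, d \in compatible_diagonals T -> A d <= c d]].

(* F_c^{set0} is a Stasheff polytope. *)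
Definition stasheff_polytope (R : realType) (n : nat)
    (c : gon_diagonal n -> R) : Prop :=
  forall T1 T2 : {set gon_diagonal n},
    partial_triangulation T1 -> partial_triangulation T2 ->
    T1 \subset T2 -> face c T2 `<=` face c T1.

(* The coordinate system attached to a complete triangulation T, which has n
   elements. *)
Definition coordinates (R : realType) (n : nat) (T : {set gon_diagonal n})
    (A : gon_diagonal n -> R) : 'rV[R]_#|T| :=
  \row_(i < #|T|) A (enum_val i).

Definition affine_hull (R : realType) (m : nat) (X : set 'rV[R]_m) :
    set 'rV[R]_m :=
  [set y | exists (k : nat) (a : 'I_k -> R) (x : 'I_k -> 'rV[R]_m),
     [/\ forall i, X (x i), \sum_(i < k) a i = 1 &
         y = \sum_(i < k) a i *: x i]].

(* The dimension of a nonempty convex set is that of its affine hull. The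
   empty set has no dimension in this sense. *)
Definition has_dimension (R : realType) (m : nat) (X : set 'rV[R]_m)
    (k : nat) : Prop :=
  exists (x0 : 'rV[R]_m) (V : {vspace 'rV[R]_m}),
    \dim V = k /\ affine_hull X = [set y | y - x0 \in V].

(* The subtraction is never truncated: partial triangulations have at most n
   elements. *)
Definition nondegenerate_polytope (R : realType) (n : nat)
    (c : gon_diagonal n -> R) : Prop :=
  forall T T' : {set gon_diagonal n},
    partial_triangulation T -> complete_triangulation T' -> T \subset T' ->
    has_dimension (coordinates T' @` face c T) (n - #|T|)%N.

(* Main.v *)
Require Import Defs.
From mathcomp Require Import all_boot all_order all_algebra.
From mathcomp Require Import boolp classical_sets reals.
From mathcomp Require Import zify lra.

Import Order.TTheory GRing.Theory Num.Theory.
Local Open Scope ring_scope.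

Set Implicit Arguments.
Unset Strict Implicit.
Unset Printing Implicit Defensive.

(** Two facts about tropical points carry both equivalences.

    Bounds propagate ([le_seg_val_of_triangulation]). Suppose that a tropical
    point A satisfies A = c on a partial triangulation T and A <= c on the
    diagonals compatible with T. If a diagonal pr crosses an element qs of
    T, then A_pr = max(A_pq + A_rs, A_qr + A_ps) - c_qs, and the four sides cross
    fewer elements of T than pr does; by induction A_pr is then at most
    max(c_pq + c_rs, c_qr + c_ps) - c_qs, which the inequalities bound by c_pr.
    So the face of T lies in the face of each subset of T. If the inequalities hold with a
    margin eps > 0, the same induction allows A to drop below c on T by up to
    eps.

    Coordinates are arbitrary ([exists_tropical_point]): on a complete
    triangulation T' a tropical point takes any prescribed values. Cut the polygon
    open at a side and set A_ij = g_i + g_j + max (- g_k - g_(k+1)), the maximum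
    being over i <= k < j. This is a tropical point for every g, and going down
    the tree of triangles of T' from the cut side, each triangle gives one
    equation that determines g at its apex ([exists_tree_point]). The same tree
    shows that T' has n elements ([card_complete_triangulation]).

    From the inequalities to the geometry, the first fact gives the Stasheff
    property. If the inequalities are strict, it shows that the face of T contains
    all points whose coordinates on T' are c on T and lie in [c - eps, c] on the
    rest of T'; such a box spans an affine space of dimension n - #|T|.

    Conversely, take a quadrilateral i, k, j, l and a complete triangulation
    containing its sides and ij. The tropical point equal to c there lies, for a
    Stasheff polytope, below c on kl, and the Ptolemy relation becomes the weak
    inequality. In the non-degenerate case remove ij: the face that remains has
    dimension 1, while the Ptolemy relation would make it a point if the
    inequality were not strict ([nondegenerate_inequalities]). *)

(** * Cyclic order and diagonals of the polygon *)

Section CyclicOrder.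
Variable n : nat.
Implicit Types (p q r s u v : 'I_n.+3) (d e : gon_diagonal n) (T : {set gon_diagonal n}).

Lemma clockwiseC p q r s : clockwise p q r s = clockwise r s p q.
Proof. by rewrite /clockwise /increasing; lia. Qed.
Lemma clockwiseR p q r s : clockwise p q r s = clockwise q r s p.
Proof. by rewrite /clockwise /increasing; lia. Qed.

Lemma set2C p q : [set p; q]%SET = [set q; p]%SET.
Proof. exact: finset.setUC. Qed.

Lemma set2_eq p q r s : [set p; q]%SET = [set r; s]%SET ->
  (p = r /\ q = s) \/ (p = s /\ q = r).
Proof.
move=> /setP E; move: (E p) (E q) (E r) (E s); rewrite !inE !eqxx ?orbT /=.
by do ![case: eqP => // ?]; subst; auto.
Qed.

(** In increasing order of the labels, adjacency modulo n + 3 leaves two cases: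
    consecutive labels, and the side joining the last vertex to the first. *)
Lemma is_diagonalE p q : (p < q)%N ->
  is_diagonal [set p; q]%SET =
    (p.+1 < q)%N && ~~ ((p == 0 :> nat) && (q == n.+2 :> nat))%N.
Proof.
move=> pq.
have adjE (i j : 'I_n.+3) : adjacent i j =
    [|| j == i.+1 :> nat, (j == 0 :> nat) && (i == n.+2 :> nat),
        i == j.+1 :> nat | (i == 0 :> nat) && (j == n.+2 :> nat)]%N.
  have S (a b : 'I_n.+3) : (b == ordS a) =
      ((b == a.+1 :> nat) || (b == 0 :> nat) && (a == n.+2 :> nat))%N.
    rewrite -val_eqE /=; have := (ltn_ord a, ltn_ord b) => -[].
    case: (eqVneq (val a) n.+2) => [/= ->|/= na] ha hb; first by rewrite modnn; lia.
    by rewrite modn_small; lia.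
  by rewrite /adjacent !S !orbA.
have := ltn_ord q; have := ltn_ord p => hp hq.
apply/idP/idP.
  case/existsP => i /existsP [j] /and3P [ij]; rewrite adjE => aij /eqP /set2_eq.
  by case=> -[? ?]; subst; move: ij aij; rewrite -!val_eqE /=; lia.
move=> H; rewrite /is_diagonal; apply/existsP; exists p; apply/existsP; exists q.
by rewrite eqxx andbT adjE -val_eqE /=; lia.
Qed.

(** The definition of [crosses] lets the endpoints of each diagonal be named in
    either order; for fixed names one rotation class remains for each
    orientation of the second diagonal. *)
Lemma clockwise_crosses d e p q r s :
  val d = [set p; r]%SET -> val e = [set q; s]%SET ->
  crosses d e = clockwise p q r s || clockwise p s r q.
Proof.
move=> dE eE; apply/idP/idP.
  case/existsP => p' /existsP [q'] /existsP [r'] /existsP [s'] /and3P [cw].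
  rewrite dE eE => /eqP /set2_eq [] [? ?] /eqP /set2_eq [] [? ?]; subst; move: cw;
  rewrite /clockwise /increasing; lia.
case/orP=> cw; apply/existsP; exists p; apply/existsP.
  by exists q; apply/existsP; exists r; apply/existsP; exists s; rewrite cw dE eE !eqxx.
exists s; apply/existsP; exists r; apply/existsP; exists q.
by rewrite cw dE eE (set2C q s) !eqxx.
Qed.

Lemma diagonal_ends d : exists pq : 'I_n.+3 * 'I_n.+3,
  (pq.1 < pq.2)%N /\ val d = [set pq.1; pq.2]%SET.
Proof.
case: d => s /= /existsP [i] /existsP [j] /and3P [ij _ /eqP ->].
have /orP[h|h] : (i < j)%N || (j < i)%N by move: ij; rewrite -val_eqE /=; lia.
- by exists (i, j).
- by exists (j, i); rewrite set2C.
Qed.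

Lemma clockwise_diagonal p q r s : clockwise p q r s -> is_diagonal [set p; r]%SET.
Proof.
have := (ltn_ord p, ltn_ord q, ltn_ord r, ltn_ord s) => -[[[? ?] ?] ?] cw.
have /orP[h|h] : (p < r)%N || (r < p)%N by move: cw; rewrite /clockwise /increasing; lia.
  by rewrite is_diagonalE //; move: cw; rewrite /clockwise /increasing; lia.
by rewrite set2C is_diagonalE //; move: cw; rewrite /clockwise /increasing; lia.
Qed.

End CyclicOrder.

(** * Upper bounds propagate from a partial triangulation *)

Section Segments.
Variables (R : realType) (n : nat).
Implicit Types (p q r s u v : 'I_n.+3) (d e : gon_diagonal n)
  (T : {set gon_diagonal n}) (f c A : gon_diagonal n -> R).

(** The numerical step of the propagation of bounds: the Ptolemy relation
    expresses [pr] through the four sides and [qs]. All sides occur in it with a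
    positive sign and are bounded above; [qs] occurs with a negative sign, and
    the loss [eps] in its lower bound is absorbed by the gap. *)
Lemma le_of_ptolemy (eps pq qr rs ps pr qs pq' qr' rs' ps' pr' qs' : R) :
  pr + qs = Num.max (pq + rs) (qr + ps) ->
  Num.max (pq' + rs') (qr' + ps') + eps <= pr' + qs' ->
  qs' - eps <= qs -> pq <= pq' -> qr <= qr' -> rs <= rs' -> ps <= ps' ->
  pr <= pr'.
Proof.
move=> eqA; rewrite -lerBrDr ge_max => /andP [gap1 gap2] ? ? ? ? ?.
have : pr + qs <= pr' + qs' - eps by rewrite eqA ge_max; apply/andP; split; lra.
lra.
Qed.

Lemma seg_val_diagonal f d p q : val d = [set p; q]%SET -> seg_val f p q = f d.
Proof. by move=> E; rewrite /seg_val -E valK. Qed.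

Lemma seg_val_edge f p q : ~~ is_diagonal [set p; q]%SET -> seg_val f p q = 0.
Proof. by move=> E; rewrite /seg_val insubN. Qed.

Lemma seg_valC f p q : seg_val f p q = seg_val f q p.
Proof. by rewrite /seg_val set2C. Qed.

Lemma diagonal_of p q : is_diagonal [set p; q]%SET ->
  exists d : gon_diagonal n, val d = [set p; q]%SET.
Proof. by move=> pq; exists (Sub _ pq). Qed.

Lemma crosses_sym d e : crosses d e = crosses e d.
Proof.
have [[p r] [_ /= dE]] := diagonal_ends d; have [[q s] [_ /= eE]] := diagonal_ends e.
rewrite (clockwise_crosses dE eE) (clockwise_crosses eE dE).
by rewrite [in RHS]clockwiseR [clockwise q r s p]clockwiseR clockwiseC orbC.
Qed.

Lemma crosses_irr d : crosses d d = false.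
Proof.
have [[p r] [_ /= dE]] := diagonal_ends d.
by rewrite (clockwise_crosses dE dE) /clockwise /increasing; lia.
Qed.

(** A chord entering the quadrilateral through pq without crossing its diagonal qs
    exits at s or through ps, hence crosses pr; one entering through qr exits at s
    or through rs. *)
Lemma clockwise_nest p q r s u v : clockwise p q r s ->
  (clockwise p u q v -> ~~ clockwise q v s u -> clockwise p u r v) /\
  (clockwise q u r v -> ~~ clockwise q u s v -> clockwise p u r v).
Proof.
by move=> cw; split; move: cw; rewrite /clockwise /increasing;
  case/or4P => /and3P [? ? ?]; case/or4P => /and3P [? ? ?]; lia.
Qed.

Lemma clockwise_neq p q r s : clockwise p q r s ->
  [/\ p != q, q != r, r != s & p != s].
Proof. by rewrite /clockwise /increasing -!val_eqE /=; split; lia. Qed.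

(** The pair p, r is allowed to be a side of the polygon, since the sides of a
    quadrilateral may be. *)
Definition crossing T p r : {set gon_diagonal n} :=
  [set e in T | [exists q, exists s, clockwise p q r s && (val e == [set q; s]%SET)]]%SET.

Lemma crossingP T p r e q s : val e = [set q; s]%SET ->
  (e \in crossing T p r) = (e \in T) && (clockwise p q r s || clockwise p s r q).
Proof.
move=> eE; rewrite inE; congr andb; apply/existsP/idP.
  case=> q' /existsP [s' /andP [cw]]; rewrite eE => /eqP /set2_eq [] [? ?]; subst.
    by rewrite cw.
  by rewrite cw orbT.
case/orP=> cw; [exists q; apply/existsP; exists s|exists s; apply/existsP; exists q].
  by rewrite cw eE eqxx.
by rewrite cw eE set2C eqxx.
Qed.

Lemma crossingC T p r : crossing T p r = crossing T r p.
Proof.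
apply/setP => e; have [[q s] [_ /= eE]] := diagonal_ends e.
rewrite !(crossingP _ _ _ eE).
by rewrite [clockwise r q p s]clockwiseC [clockwise r s p q]clockwiseC orbC.
Qed.

Lemma partial_triangulationP T :
  reflect {in T &, forall d e, ~~ crosses d e} (partial_triangulation T).
Proof.
apply: (iffP idP) => [/forallP h d e dT eT|h].
  by have /implyP/(_ dT)/forallP/(_ e)/implyP := h d; exact.
apply/forallP => d; apply/implyP => dT; apply/forallP => e; apply/implyP => eT.
exact: h.
Qed.

(** An element of [T] crossing pq or qr does not cross qs, so it crosses pr; but qs
    itself crosses pr and not the two sides, with which it shares q. *)
Lemma crossing_proper T e p q r s : partial_triangulation T -> e \in T ->
  val e = [set q; s]%SET -> clockwise p q r s ->
  crossing T p q \proper crossing T p r /\ crossing T q r \proper crossing T p r.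
Proof.
move=> /partial_triangulationP pT eT eE cw.
have H x : x \in T -> exists u v,
    [/\ val x = [set u; v]%SET, ~~ clockwise q u s v & ~~ clockwise q v s u].
  move=> xT; have [[u v] [_ /= xE]] := diagonal_ends x; exists u, v.
  by have := pT _ _ eT xT; rewrite (clockwise_crosses eE xE) negb_or => /andP [].
split; apply/properP; split.
- apply/fintype.subsetP => x xX; have xT : x \in T by move: xX; rewrite inE => /andP [].
  have [u [v [xE h1 h2]]] := H x xT; move: xX; rewrite !(crossingP _ _ _ xE) xT /=.
  case/orP => h; first by rewrite (clockwise_nest u v cw).1.
  by rewrite (clockwise_nest v u cw).1 ?orbT.
- by exists e => //; rewrite (crossingP _ _ _ eE) eT ?cw //= /clockwise /increasing; lia.
- apply/fintype.subsetP => x xX; have xT : x \in T by move: xX; rewrite inE => /andP [].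
  have [u [v [xE h1 h2]]] := H x xT; move: xX; rewrite !(crossingP _ _ _ xE) xT /=.
  case/orP => h; first by rewrite (clockwise_nest u v cw).2.
  by rewrite (clockwise_nest v u cw).2 ?orbT.
- by exists e => //; rewrite (crossingP _ _ _ eE) eT ?cw //= /clockwise /increasing; lia.
Qed.

(** Induction on the number of elements of [T] that a diagonal pr crosses. If
    there is none, pr belongs to [T] or is compatible with it. Otherwise the
    Ptolemy relation on the quadrilateral formed by pr and an element qs of [T]
    crossing it reduces the bound to the four sides, which cross fewer elements
    of [T]. The Stasheff property is the case [eps = 0]; a positive [eps] leaves
    room to move the coordinates. *)
Lemma le_seg_val_of_triangulation (eps : R) c A T :
  (forall i k j l, clockwise i k j l ->
     Num.max (seg_val c i k + seg_val c j l) (seg_val c k j + seg_val c i l) + eps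
     <= seg_val c i j + seg_val c k l) ->
  tropical_points A -> partial_triangulation T ->
  (forall d, d \in T -> c d - eps <= A d) ->
  (forall d, d \in T -> A d <= c d) ->
  (forall d, d \in compatible_diagonals T -> A d <= c d) ->
  forall d, A d <= c d.
Proof.
move=> gap tA pT lowT upT upS.
suff H p r : p != r -> seg_val A p r <= seg_val c p r.
  move=> d; have [[p r] [/= pr dE]] := diagonal_ends d.
  by rewrite -!(seg_val_diagonal _ dE); apply: H; rewrite -val_eqE /=; lia.
have [m] := ubnP #|crossing T p r|; elim: m p r => // m IH p r; rewrite ltnS => leXm pr.
have [pr_diag|/[dup] /(seg_val_edge A) -> /(seg_val_edge c) ->] // :=
  boolP (is_diagonal [set p; r]%SET).
have [d dE] := diagonal_of pr_diag.
have [X0|[e eX]] := set_0Vmem (crossing T p r).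
  rewrite !(seg_val_diagonal _ dE); have [/upT //|dT] := boolP (d \in T).
  apply: upS; rewrite inE dT; apply/forallP => e; apply/implyP => eT.
  have [[q s] [_ /= eE]] := diagonal_ends e.
  have : e \notin crossing T p r by rewrite X0 inE.
  rewrite (crossingP _ _ _ eE) eT /=.
  by rewrite (clockwise_crosses dE eE) => ->.
have {eX} [q [s [eT eE cw]]] : exists q s,
    [/\ e \in T, val e = [set q; s]%SET & clockwise p q r s].
  have [[q s] [_ /= eE]] := diagonal_ends e.
  move: eX; rewrite (crossingP _ _ _ eE) => /andP [eT] /orP [] cw; first by exists q, s.
  by exists s, q; rewrite set2C.
have cw' : clockwise r s p q by rewrite clockwiseC.
have [Xpq Xqr] := crossing_proper pT eT eE cw.
have [] := crossing_proper pT eT _ cw'; first by rewrite set2C.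
rewrite [crossing T r p]crossingC [crossing T s p]crossingC => Xrs Xps.
have sub a b : a != b -> crossing T a b \proper crossing T p r ->
    seg_val A a b <= seg_val c a b.
  by move=> ab X; apply: IH => //; apply: leq_trans (proper_card X) leXm.
have [pq qr rs ps] := clockwise_neq cw.
apply: (le_of_ptolemy (tA _ _ _ _ cw) (gap _ _ _ _ cw)); try exact: sub.
by rewrite !(seg_val_diagonal _ eE) lowT.
Qed.

(** Otherwise [d] could be added to [T]. *)
Lemma complete_compatible T d : complete_triangulation T ->
  (forall e, e \in T -> ~~ crosses d e) -> d \in T.
Proof.
move=> /maxsetP [/partial_triangulationP pT maxT] dT.
suff <- : d |: T = T by rewrite setU11.
apply: maxT; last exact: finset.subsetUr.
apply/partial_triangulationP => x y /setU1P [->|xT] /setU1P [->|yT].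
- by rewrite crosses_irr.
- exact: dT.
- by rewrite crosses_sym dT.
- exact: pT.
Qed.

End Segments.

(** * An explicit family of tropical points *)

Section IntervalMax.
Variable R : realType.
Implicit Types (h g : nat -> R) (i j k l m : nat).

(** The maximum of [h k] over i <= k < j; the value 0 is a dummy for j <= i. *)
Fixpoint interval_max h i j : R :=
  if j is j'.+1 then
    if (i < j')%N then Num.max (interval_max h i j') (h j') else h i
  else 0.

Lemma interval_maxS h i j : (i < j)%N ->
  interval_max h i j.+1 = Num.max (interval_max h i j) (h j).
Proof. by move=> /= ->. Qed.

Lemma interval_max1 h i : interval_max h i i.+1 = h i.
Proof. by rewrite /= ltnn. Qed.

Lemma interval_max_split h i m j : (i < m)%N -> (m < j)%N ->
  interval_max h i j = Num.max (interval_max h i m) (interval_max h m j).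
Proof.
move=> im; elim: j => // j IH; rewrite ltnS leq_eqVlt => /orP [/eqP <-|mj].
  by rewrite interval_maxS // interval_max1.
by rewrite !interval_maxS ?(ltn_trans im) // IH // maxA.
Qed.

Lemma eq_interval_max h h' i j : (forall k, (i <= k < j)%N -> h k = h' k) ->
  (i < j)%N -> interval_max h i j = interval_max h' i j.
Proof.
elim: j => // j IH eqh ij; rewrite /=; case: ifP => ij'; last by rewrite eqh // leqnn.
rewrite eqh; last by rewrite leqnn (ltnW ij').
by rewrite IH // => k /andP [ik kj]; rewrite eqh // ik ltnS ltnW.
Qed.

(** The tropicalization of the Plucker coordinates of the 2 x N matrix with
    columns [g_i * (1, x_i)], the [x_i] increasing: the determinant of columns i
    and j is [g_i * g_j * (x_j - x_i)], and x_j - x_i is the sum of the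
    successive increments, which tropicalizes to a maximum. The increments are
    chosen so that consecutive columns have determinant 1, tropically 0. *)
Definition tree_point g i j : R :=
  g i + g j + interval_max (fun k => - g k - g k.+1) i j.

Lemma tree_point_side g i : tree_point g i i.+1 = 0.
Proof. by rewrite /tree_point interval_max1; lra. Qed.

(** With a, b, d the maxima over the three successive intervals, the relation is
    max(a,b) + max(b,d) = max(a + d, b + max(a,b,d)). *)
Lemma tree_point_ptolemy g i j k l : (i < j)%N -> (j < k)%N -> (k < l)%N ->
  tree_point g i k + tree_point g j l =
  Num.max (tree_point g i j + tree_point g k l) (tree_point g j k + tree_point g i l).
Proof.
move=> ij jk kl; rewrite /tree_point.
rewrite (interval_max_split _ ij (ltn_trans jk kl)) (interval_max_split _ jk kl).
rewrite (interval_max_split _ ij jk).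
set a := interval_max _ i j; set b := interval_max _ j k; set d := interval_max _ k l.
case: (leP b d) => bd; case: (leP a d) => ad; case: (leP a b) => ab;
  case: (leP (_ + _) (_ + _)) => h; lra.
Qed.

End IntervalMax.

(** * Solving for a tropical point along a triangulation *)

Section Arcs.
Variables (R : realType) (arc : rel nat).
Hypothesis arc_lt : forall i j, arc i j -> (i < j)%N.
Hypothesis arc_noncrossing : forall i k j l, arc i j -> arc k l ->
  ~~ [&& (i < k)%N, (k < j)%N & (j < l)%N].
Hypothesis arc_apex : forall i j, arc i j -> (i.+1 < j)%N ->
  exists m, [/\ (i < m < j)%N, arc i m & arc m j].

(** Cutting along the triangle with base ij and apex m turns an arc into two
    shorter ones. *)
Lemma arc_ind (P : nat -> nat -> Prop) :
  (forall i, arc i i.+1 -> P i i.+1) ->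
  (forall i m j, (i < m < j)%N -> arc i m -> arc m j -> arc i j ->
     P i m -> P m j -> P i j) ->
  forall i j, arc i j -> P i j.
Proof.
move=> P1 PS i j; have [k] := ubnP (j - i)%N; elim: k i j => // k IH i j lek aij.
have [ij|] := ltnP i.+1 j.
  have [m [imj aim amj]] := arc_apex aij ij.
  by apply: (PS i m j) => //; apply: IH => //; lia.
move=> ji; have ij := arc_lt aij; have jE : j = i.+1 by lia.
by move: aij; rewrite jE; exact: P1.
Qed.

(** An arc passing over the apex m would cross one of the sides im, mj, unless it
    is the base of the triangle. *)
Lemma arc_below_apex i m j a b : arc i m -> arc m j -> arc a b ->
  (i <= a)%N -> (b <= j)%N -> [\/ a = i /\ b = j, (b <= m)%N | (m <= a)%N].
Proof.
move=> aim amj aab ia bj.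
have [?|mb] := leqP b m; first by constructor 2.
have [?|am] := leqP m a; first by constructor 3.
constructor 1; have := arc_noncrossing aim aab; have := arc_noncrossing aab amj; lia.
Qed.

(** The potential [g] is built from the base ab downwards: once its values at a
    and b are chosen, prescribing the value [y] on the three sides of the
    triangle a, m, b means that the maxima over [a,m] and [m,b] are
    y_am - g_a - g_m and y_mb - g_m - g_b and that the larger of them is
    y_ab - g_a - g_b. This equation determines g_m, and the two sides am, mb are
    then treated separately. *)
Lemma exists_tree_point (y : nat -> nat -> R) :
  (forall i, y i i.+1 = 0) ->
  forall a b, arc a b -> forall ga gb : R, exists g : nat -> R,
    [/\ g a = ga, g b = gb &
      forall i j, arc i j -> (a <= i)%N -> (j <= b)%N -> tree_point g i j = y i j].
Proof.
move=> y1; apply: arc_ind => [a _ ga gb|a m b amb aam amb' aab IHl IHr ga gb].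
  exists (fun k => if k == a then ga else gb); rewrite eqxx; split=> //.
    by case: eqP => // ?; lia.
  move=> i j /arc_lt ? ? ?; have -> : i = a by lia.
  by have -> : j = a.+1 by [lia]; rewrite y1 tree_point_side.
(* The only value at m compatible with the triangle a, m, b. *)
pose gm := Num.max (y a m - ga) (y m b - gb) - (y a b - ga - gb).
have [gl [gla glm Hl]] := IHl ga gm; have [gr [grm grb Hr]] := IHr gm gb.
pose g k := if (k <= m)%N then gl k else gr k.
have El i j : (i < j)%N -> (j <= m)%N -> tree_point g i j = tree_point gl i j.
  move=> ij jm; rewrite /tree_point /g !ifT; [|lia..]; congr (_ + _).
  by apply: eq_interval_max => // k kij; rewrite !ifT //; lia.
have gE k : (m <= k)%N -> g k = gr k.
  rewrite leq_eqVlt /g => /orP [/eqP <-|mk]; first by rewrite leqnn glm grm.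
  by rewrite leqNgt mk.
have Er i j : (i < j)%N -> (m <= i)%N -> tree_point g i j = tree_point gr i j.
  move=> ij mi; rewrite /tree_point !gE; [|lia..]; congr (_ + _).
  by apply: eq_interval_max => // k kij; rewrite !gE //; lia.
have [am mb] : (a < m)%N /\ (m < b)%N by lia.
have g_a : g a = ga by rewrite /g ltnW.
have g_m : g m = gm by rewrite gE.
have g_b : g b = gb by rewrite gE // ltnW.
exists g; split=> //.
move=> i j aij ai jb; have ij := arc_lt aij.
have [[-> ->]|jm|mi] := arc_below_apex aam amb' aij ai jb.
- have := Hl _ _ aam (leqnn a) (leqnn m); rewrite -El //.
  have := Hr _ _ amb' (leqnn m) (leqnn b); rewrite -Er //.
  rewrite /tree_point (interval_max_split _ am mb) g_a g_m g_b.
  set M1 := interval_max _ _ _; set M2 := interval_max _ _ _; rewrite /gm.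
  by case: (leP M1 M2) => h; case: (leP (_ - _) (_ - _)) => h'; lra.
- by rewrite El // Hl.
- by rewrite Er // Hr.
Qed.

(** Each triangle removes one arc and splits b - a into two parts, so there are
    b - a - 1 arcs over the interval, its base included and the sides of the
    polygon excluded. *)
Lemma arc_enum a b : arc a b -> exists s : seq (nat * nat),
  [/\ uniq s, size s = (b - a).-1 &
    forall ij, (ij \in s) =
      [&& arc ij.1 ij.2, (ij.1.+1 < ij.2)%N, (a <= ij.1)%N & (ij.2 <= b)%N]].
Proof.
move: a b; apply: arc_ind => [a aa|a m b amb aam amb' aab].
  exists [::]; split=> // [|[i j] /=]; first by rewrite subSnn.
  by rewrite in_nil; case: (arc i j) => //=; lia.
move=> [s [us szs sP]] [t [ut szt tP]]; exists ((a, b) :: s ++ t); split.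
- rewrite /= mem_cat !sP !tP cat_uniq us ut /= andbT.
  apply/andP; split.
    by rewrite negb_or; apply/andP; split; apply/negP => /and4P [_ /=]; lia.
  apply/hasPn => -[i j]; rewrite sP tP /= => /and4P [_ ? ? ?].
  by apply/negP => /and4P [_]; lia.
- by rewrite /= size_cat szs szt; lia.
case=> i j; rewrite inE mem_cat sP tP xpair_eqE /=.
apply/idP/idP.
  by case/or3P => [/andP [/eqP -> /eqP ->]|/and4P [-> /=]|/and4P [-> /=]];
    rewrite ?aab; lia.
case/and4P => aij ij ai jb; have [[-> ->]|jm|mi] := arc_below_apex aam amb' aij ai jb.
- by rewrite !eqxx.
- by rewrite aij ij ai jm orbT.
- by rewrite aij ij mi jb !orbT.
Qed.

End Arcs.

(** * Complete triangulations *)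

Section Triangulation.
Variables (n : nat) (T : {set gon_diagonal n}).
Hypothesis completeT : complete_triangulation T.
Implicit Types (p q r s : 'I_n.+3) (d e : gon_diagonal n).

(** A triangulation together with the n + 3 sides of the polygon, which is cut
    open at the side joining the last vertex to the first; that side becomes the
    arc over all the others. *)
Definition triangulation_arc : rel nat := fun i j =>
  [&& (i < j)%N, (j < n.+3)%N &
      is_diagonal [set inord i; inord j : 'I_n.+3]%SET ==>
        [exists d in T, val d == [set inord i; inord j]%SET]].
Local Notation arc := triangulation_arc.

Lemma triangulation_noncrossing d e : d \in T -> e \in T -> ~~ crosses d e.
Proof. by have /maxsetP [/partial_triangulationP pT _] := completeT; apply: pT. Qed.

Lemma triangulation_arcP i j : arc i j -> exists p q,
  [/\ p = i :> nat, q = j :> nat, (i < j)%N &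
  is_diagonal [set p; q]%SET -> exists2 d, d \in T & val d = [set p; q]%SET].
Proof.
case/and3P => ij jn /implyP H; exists (inord i), (inord j).
split; rewrite ?inordK //; first exact: ltn_trans jn.
by move=> /H /existsP [d /andP [dT /eqP dE]]; exists d.
Qed.

Lemma triangulation_arcE p q : (p < q)%N ->
  (is_diagonal [set p; q]%SET -> exists2 d, d \in T & val d = [set p; q]%SET) -> arc p q.
Proof.
move=> pq H; rewrite /arc pq ltn_ord !inord_val /=; apply/implyP => /H [d dT dE].
by apply/existsP; exists d; rewrite dT dE eqxx.
Qed.

Lemma triangulation_arc_lt i j : arc i j -> (i < j)%N.
Proof. by case/and3P. Qed.

Lemma triangulation_arc_noncrossing i k j l : arc i j -> arc k l ->
  ~~ [&& (i < k)%N, (k < j)%N & (j < l)%N].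
Proof.
move=> /triangulation_arcP [p [r [<- <- pr prT]]].
move=> /triangulation_arcP [q [s [<- <- qs qsT]]].
apply/negP => /and3P [pq qr rs].
have cw : clockwise p q r s by rewrite /clockwise /increasing pq qr rs.
have [d dT dE] := prT (clockwise_diagonal cw).
have [|e eT eE] := qsT.
  by apply: (@clockwise_diagonal _ q r s p); rewrite -clockwiseR.
by have := triangulation_noncrossing dT eT; rewrite (clockwise_crosses dE eE) cw.
Qed.

Lemma triangulation_side i : (i < n.+2)%N -> arc i i.+1.
Proof.
move=> lti; rewrite /arc ltnS leqnn ltnS lti /=; apply/implyP.
by rewrite is_diagonalE !inordK //; lia.
Qed.

Lemma triangulation_root : arc 0 n.+2.
Proof.
rewrite /arc /= ltnSn; apply/implyP.
by rewrite is_diagonalE !inordK //; lia.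
Qed.

Lemma triangulation_arc_of_diagonal d p q :
  d \in T -> val d = [set p; q]%SET -> (p < q)%N -> arc p q.
Proof. by move=> dT dE pq; apply: triangulation_arcE => // _; exists d. Qed.

(** The apex of the triangle below the arc ij is the farthest vertex m joined to
    i. Whatever crosses mj would cross ij or im, or start at i and end beyond m;
    so maximality of the triangulation puts mj into it. *)
Lemma triangulation_arc_apex i j : arc i j -> (i.+1 < j)%N ->
  exists m, [/\ (i < m < j)%N, arc i m & arc m j].
Proof.
move=> aij ij; have ltj : (j < n.+3)%N by case/and3P: aij.
have ex : exists m, (m < j)%N && arc i m.
  by exists i.+1; rewrite ij triangulation_side //; lia.
have ub m : (m < j)%N && arc i m -> (m <= j)%N by case/andP => /ltnW.
case: (ex_maxnP ex ub) => m /andP [mj aim] maxm; exists m.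
have im := triangulation_arc_lt aim; split=> //; first by rewrite im.
have [p pm] : exists p : 'I_n.+3, p = m :> nat by exists (Ordinal (ltn_trans mj ltj)).
have [q qj] : exists q : 'I_n.+3, q = j :> nat by exists (Ordinal ltj).
rewrite -pm -qj; apply: triangulation_arcE; first by rewrite pm qj.
move=> /diagonal_of [d dE]; exists d => //; apply: complete_compatible => // e eT.
have [[r s] [/= rs eE]] := diagonal_ends e.
have ars := triangulation_arc_of_diagonal eT eE rs.
have h1 := triangulation_arc_noncrossing ars aij.
have h2 := triangulation_arc_noncrossing aij ars.
have h3 := triangulation_arc_noncrossing aim ars.
have h4 : (i = r -> s < j -> s <= m)%N.
  by move=> ir sj; apply: maxm; rewrite sj ir.
rewrite (clockwise_crosses dE eE) /clockwise /increasing pm qj.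
by move: h1 h2 h3 h4 rs; lia.
Qed.

(** The arcs over [0, n + 2] are the elements of [T] and the root arc. *)
Lemma card_complete_triangulation : #|T| = n.
Proof.
have [E EP] := choice (@diagonal_ends n).
have [s [us szs sP]] := arc_enum triangulation_arc_lt triangulation_arc_noncrossing
  triangulation_arc_apex triangulation_root.
pose f d : nat * nat := ((E d).1 : nat, (E d).2 : nat).
have injf : injective f.
  move=> d e [/val_inj e1 /val_inj e2]; apply: val_inj.
  by have [_ ->] := EP d; have [_ ->] := EP e; rewrite e1 e2.
have : size ((0, n.+2)%N :: [seq f d | d <- enum T]) = size s.
  apply/perm_size/uniq_perm => //.
    rewrite /= map_inj_uniq // enum_uniq andbT; apply/mapP => -[d _ [d0 dn]].
    have [lt dE] := EP d; have := valP d; rewrite /= dE is_diagonalE //; lia.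
  case=> i j; rewrite sP inE xpair_eqE /=.
  apply/idP/idP.
    case/orP => [/andP [/eqP -> /eqP ->]|]; first by rewrite triangulation_root; lia.
    case/mapP => d; rewrite mem_enum => dT [-> ->].
    have [lt dE] := EP d; rewrite (triangulation_arc_of_diagonal dT dE lt) /=.
    by have := valP d; have := ltn_ord (E d).2; rewrite /= dE is_diagonalE //; lia.
  case/and3P => /triangulation_arcP [p [q [<- <- pq pqT]]] pq1 qn.
  apply/orP; have [pq0|pq0] := boolP ((p == 0 :> nat) && (q == n.+2 :> nat))%N.
    by left.
  right; have [|d dT dE] := pqT; first by rewrite is_diagonalE // pq1.
  apply/mapP; exists d; rewrite ?mem_enum // /f.
  have [lt dE'] := EP d; move: dE'; rewrite dE => /set2_eq [] [? ?]; subst => //.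
  lia.
by rewrite szs /= size_map -cardE => -[].
Qed.

(** Surjectivity of the coordinate system attached to a complete triangulation. *)
Lemma exists_tropical_point (R : realType) (y : gon_diagonal n -> R) :
  exists2 A, tropical_points A & forall d, d \in T -> A d = y d.
Proof.
have [E EP] := choice (@diagonal_ends n).
pose Y (i j : nat) := seg_val y (inord i) (inord j).
have YE p q : Y p q = seg_val y p q by rewrite /Y !inord_val.
(* The default value covers i + 1 = n + 3, which is not a vertex. *)
pose Y' i j := if arc i j then Y i j else 0.
have Y'1 i : Y' i i.+1 = 0.
  rewrite /Y'; case: ifP => // /and3P [_ lti _]; rewrite /Y seg_val_edge //.
  by rewrite is_diagonalE !inordK //; lia.
have [g [_ _ gP]] := exists_tree_point triangulation_arc_lt triangulation_arc_noncrossing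
  triangulation_arc_apex Y'1 triangulation_root 0 0.
pose A d := tree_point g (E d).1 (E d).2.
have AE p q : (p < q)%N -> seg_val A p q = tree_point g p q.
  move=> pq; have [/diagonal_of [d dE]|nd] := boolP (is_diagonal [set p; q]%SET).
    rewrite (seg_val_diagonal _ dE) /A; have [lt dE'] := EP d.
    by move: dE' pq; rewrite dE => /set2_eq [] [-> ->] //; lia.
  rewrite seg_val_edge //; move: nd; rewrite is_diagonalE // negb_and negbK -leqNgt.
  case/orP => [qp|/andP [/eqP -> /eqP ->]].
    by have -> : nat_of_ord q = p.+1 by [lia]; rewrite tree_point_side.
  rewrite gP ?triangulation_root // /Y' triangulation_root /Y seg_val_edge //.
  by rewrite is_diagonalE !inordK //; lia.
have incA p q r s : increasing p q r s -> seg_val A p r + seg_val A q s =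
     Num.max (seg_val A p q + seg_val A r s) (seg_val A q r + seg_val A p s).
  case/and3P => pq qr rs; have pr := ltn_trans pq qr; have qs := ltn_trans qr rs.
  have ps := ltn_trans pr rs.
  rewrite (AE _ _ pr) (AE _ _ qs) (AE _ _ pq) (AE _ _ rs) (AE _ _ qr) (AE _ _ ps).
  exact: tree_point_ptolemy.
exists A.
  (* The Ptolemy relation is invariant under rotation of p, q, r, s. *)
  move=> p q r s /or4P [] /incA //.
  - by rewrite [seg_val A r p]seg_valC [seg_val A s p]seg_valC [seg_val A q p]seg_valC
      maxC addrC => ->; rewrite [seg_val A r s + _]addrC.
  - rewrite [seg_val A r p]seg_valC [seg_val A s q]seg_valC.
    rewrite [seg_val A r q]seg_valC [seg_val A s p]seg_valC.
    by move=> ->; rewrite [seg_val A p q + _]addrC [seg_val A q r + _]addrC.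
  - rewrite [seg_val A s q]seg_valC [seg_val A s p]seg_valC [seg_val A s r]seg_valC.
    rewrite maxC addrC => ->.
    by rewrite [seg_val A p s + _]addrC.
move=> d dT; have [lt dE] := EP d.
have ad := triangulation_arc_of_diagonal dT dE lt.
rewrite /A gP //; last by have := ltn_ord (E d).2; lia.
by rewrite /Y' ad YE (seg_val_diagonal _ dE).
Qed.

End Triangulation.

(** * Quadrilaterals and flips *)

Section Quadrilateral.
Variables (n : nat).
Implicit Types (p q r s u v i j k l : 'I_n.+3) (d e : gon_diagonal n)
  (T : {set gon_diagonal n}).

(** The quadrilateral i, k, j, l with its diagonal ij; some of these segments may
    be sides of the polygon. *)
Definition split_quadrilateral i k j l : seq {set 'I_n.+3} :=
  [:: [set i; k]; [set k; j]; [set j; l]; [set i; l]; [set i; j]]%SET.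

Lemma split_quadrilateral_noncrossing i k j l p q r s :
  clockwise i k j l -> clockwise p q r s ->
  [set p; r]%SET \in split_quadrilateral i k j l ->
  [set q; s]%SET \in split_quadrilateral i k j l -> False.
Proof.
move=> cw cw'; rewrite !inE => dT eT; move: cw cw'.
case/or4P: dT => [| | |/orP []] => /eqP/set2_eq [] [-> ->];
case/or4P: eT => [| | |/orP []] => /eqP/set2_eq [] [-> ->]; clear;
rewrite /clockwise /increasing; lia.
Qed.

(** The endpoint u lies on the same side of kl as j; if it differs from j, then kj
    or jl separates it from v. *)
Lemma clockwise_squeeze i k j l u v : clockwise i k j l -> clockwise k u l v ->
  ~~ clockwise k u j v -> ~~ clockwise j u l v -> u = j.
Proof.
move=> cw cw' h1 h2; suff : u = j :> nat by apply: val_inj.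
have : clockwise k j l v.
  move: cw cw'; clear; rewrite /clockwise /increasing.
  by case/or4P => /and3P [? ? ?]; case/or4P => /and3P [? ? ?]; lia.
move: cw' h1 h2; clear; rewrite /clockwise /increasing => cw' h1 h2 cw.
by move: cw' cw h1 h2; case/or4P => /and3P [? ? ?]; case/or4P => /and3P [? ? ?]; lia.
Qed.

Lemma clockwise_other_diagonal i k j l u v : clockwise i k j l -> clockwise k u l v ->
  ~~ clockwise k u j v -> ~~ clockwise j u l v ->
  ~~ clockwise l v i u -> ~~ clockwise i v k u -> u = j /\ v = i.
Proof.
move=> cw cw' h1 h2 h3 h4; split; first exact: clockwise_squeeze cw cw' h1 h2.
by apply: (@clockwise_squeeze j l i k v u) => //; rewrite clockwiseC.
Qed.

Lemma exists_complete_quadrilateral i k j l : clockwise i k j l ->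
  exists2 T, complete_triangulation T &
    forall d, val d \in split_quadrilateral i k j l -> d \in T.
Proof.
move=> cw.
pose T0 := [set d : gon_diagonal n | val d \in split_quadrilateral i k j l]%SET.
have pT0 : partial_triangulation T0.
  apply/partial_triangulationP => d e; rewrite !finset.in_set => dT eT; apply/negP.
  case/existsP => p /existsP [q] /existsP [r] /existsP [s] /and3P [cw' /eqP dE /eqP eE].
  rewrite dE in dT; rewrite eE in eT.
  by apply: split_quadrilateral_noncrossing cw cw' dT eT.
have [T cT sub] := maxset_exists pT0; exists T => // d dT.
by apply: (fintype.subsetP sub); rewrite finset.in_set.
Qed.

End Quadrilateral.

(** * Stasheff polytopes and the inequalities *)

Section Stasheff.
Variables (R : realType) (n : nat).
Implicit Types (p q r s u v i j k l : 'I_n.+3) (d e : gon_diagonal n)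
  (T : {set gon_diagonal n}) (f c A : gon_diagonal n -> R).

Lemma eq_seg_val A c p q : (forall d, val d = [set p; q]%SET -> A d = c d) ->
  seg_val A p q = seg_val c p q.
Proof.
move=> eqAc; have [/diagonal_of [d dE]|nd] := boolP (is_diagonal [set p; q]%SET).
  by rewrite !(seg_val_diagonal _ dE) eqAc.
by rewrite !seg_val_edge.
Qed.

Lemma complete_compatible0 T :
  complete_triangulation T -> compatible_diagonals T = finset.set0.
Proof.
move=> cT; apply/setP => d; rewrite !inE; apply/negP => /andP [/negP dT /forallP h].
by apply: dT; apply: complete_compatible => // e eT; have /implyP := h e; apply.
Qed.

Lemma split_quadrilateral_sides i k j l :
  [/\ [set i; k]%SET \in split_quadrilateral i k j l,
      [set k; j]%SET \in split_quadrilateral i k j l,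
      [set j; l]%SET \in split_quadrilateral i k j l,
      [set i; l]%SET \in split_quadrilateral i k j l &
      [set i; j]%SET \in split_quadrilateral i k j l].
Proof. by rewrite !inE !eqxx ?orbT. Qed.

(** A complete triangulation [T] containing the sides of the quadrilateral and ij
    has a vertex, the point with coordinates [c] on [T]. At this vertex the
    Ptolemy relation turns the bound on kl into the required inequality. *)
Lemma stasheff_inequalities c : stasheff_polytope c ->
  forall i k j l, clockwise i k j l ->
     Num.max (seg_val c i k + seg_val c j l) (seg_val c k j + seg_val c i l)
     <= seg_val c i j + seg_val c k l.
Proof.
move=> st i k j l cw; have [T cT QT] := exists_complete_quadrilateral cw.
have [A tA AT] := exists_tropical_point cT c.
have pT : partial_triangulation T by have /maxsetP [] := cT.
have p0 : partial_triangulation (finset.set0 : {set gon_diagonal n}).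
  by apply/partial_triangulationP => d e; rewrite inE.
have FT : face c T A by split=> // d; rewrite complete_compatible0 // inE.
have [_ _ upA] := st _ _ p0 pT (finset.sub0set T) A FT.
have [ik kj jl il ij] := split_quadrilateral_sides i k j l.
have eqQ p q : [set p; q]%SET \in split_quadrilateral i k j l ->
    seg_val A p q = seg_val c p q.
  by move=> pq; apply: eq_seg_val => d dE; apply/AT/QT; rewrite dE.
rewrite -(eqQ _ _ ik) -(eqQ _ _ kj) -(eqQ _ _ jl) -(eqQ _ _ il) -(eqQ _ _ ij).
rewrite -(tA _ _ _ _ cw) lerD2l.
have [d dE] : exists d : gon_diagonal n, val d = [set k; l]%SET.
  by apply/diagonal_of/(@clockwise_diagonal _ k j l i); rewrite -clockwiseR.
rewrite !(seg_val_diagonal _ dE); apply: upA; rewrite !inE.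
by apply/forallP => e; rewrite inE.
Qed.

Lemma inequalities_stasheff c :
  (forall i k j l, clockwise i k j l ->
     Num.max (seg_val c i k + seg_val c j l) (seg_val c k j + seg_val c i l)
     <= seg_val c i j + seg_val c k l) ->
  stasheff_polytope c.
Proof.
move=> gap T1 T2 pT1 pT2 sub A [tA eqA leA].
have up : forall d, A d <= c d.
  apply: (@le_seg_val_of_triangulation _ _ 0 _ _ T2) => //.
  - by move=> *; rewrite addr0 gap.
  - by move=> d dT; rewrite subr0 eqA.
  - by move=> d dT; rewrite eqA.
by split=> // d dT; apply: eqA; apply: (fintype.subsetP sub).
Qed.

(** Once ij is removed, nothing crosses kl: an element crossing kl but none of the
    four sides of the quadrilateral joins i to j. *)
Lemma flip_compatible T i k j l d d' : clockwise i k j l ->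
  complete_triangulation T ->
  (forall e, val e \in split_quadrilateral i k j l -> e \in T) ->
  val d = [set i; j]%SET -> val d' = [set k; l]%SET ->
  d \in compatible_diagonals (T :\ d) /\ d' \in compatible_diagonals (T :\ d).
Proof.
move=> cw cT QT dE d'E.
have [ik kj jl il ij] := split_quadrilateral_sides i k j l.
have dT : d \in T by apply: QT; rewrite dE.
have nc := triangulation_noncrossing cT.
split.
  rewrite inE !inE eqxx /=; apply/forallP => e; apply/implyP => /setD1P [_ eT].
  exact: nc.
have d'T : d' \notin T.
  apply/negP => d'T; have := nc _ _ dT d'T.
  by rewrite (clockwise_crosses dE d'E) cw.
rewrite inE !inE (negPf d'T) andbF /=.
apply/forallP => e; apply/implyP => /setD1P [/eqP ned eT].
apply/negP => d'e; apply: ned.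
have [u [v [eE cwe]]] : exists u v, val e = [set u; v]%SET /\ clockwise k u l v.
  have [[u v] [_ /= eE]] := diagonal_ends e.
  move: d'e; rewrite (clockwise_crosses d'E eE) => /orP [] h; first by exists u, v.
  by exists v, u; rewrite set2C.
have ncs p q : [set p; q]%SET \in split_quadrilateral i k j l ->
    ~~ clockwise p u q v && ~~ clockwise p v q u.
  move=> pq; have [/diagonal_of [x xE]|npq] := boolP (is_diagonal [set p; q]%SET).
    have xT : x \in T by apply: QT; rewrite xE.
    by have := nc _ _ xT eT; rewrite (clockwise_crosses xE eE) negb_or.
  by apply/andP; split; apply: contra npq => /clockwise_diagonal.
have /andP [h1 _] := ncs _ _ kj; have /andP [h2 _] := ncs _ _ jl.
have /andP [h3 _] := ncs _ _ il; have /andP [_ h4] := ncs _ _ ik.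
rewrite clockwiseC in h3.
have [? ?] := clockwise_other_diagonal cw cwe h1 h2 h3 h4; subst.
by apply: val_inj; rewrite eE dE set2C.
Qed.

(** Removing ij from a complete triangulation that contains the sides of the
    quadrilateral leaves a face on which only A_ij varies, under the bounds
    A_ij <= c_ij and A_kl <= c_kl. By the Ptolemy relation A_ij + A_kl is the
    maximum computed from [c]; if that maximum is at least c_ij + c_kl, both
    bounds are equalities and the face is a point instead of a segment. *)
Lemma nondegenerate_inequalities c : nondegenerate_polytope c ->
  forall i k j l, clockwise i k j l ->
     Num.max (seg_val c i k + seg_val c j l) (seg_val c k j + seg_val c i l)
     < seg_val c i j + seg_val c k l.
Proof.
move=> nd i k j l cw; rewrite ltNge; apply/negP => le_c.
have [T' cT QT] := exists_complete_quadrilateral cw.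
have pT' : partial_triangulation T' by have /maxsetP [] := cT.
have [ik kj jl il ij] := split_quadrilateral_sides i k j l.
have cw' : clockwise k j l i by rewrite -clockwiseR.
have [d dE] := diagonal_of (clockwise_diagonal cw).
have [d' d'E] := diagonal_of (clockwise_diagonal cw').
have dT' : d \in T' by apply: QT; rewrite dE.
have [dS d'S] := flip_compatible cw cT QT dE d'E.
pose T := T' :\ d.
have pT : partial_triangulation T.
  apply/partial_triangulationP => x y /setD1P [_ xT] /setD1P [_ yT].
  by apply: (triangulation_noncrossing cT).
have faceE A : face c T A -> coordinates T' A = coordinates T' c.
  case=> tA eqA leA.
  have eqQ p q : [set p; q]%SET \in split_quadrilateral i k j l ->
      [set p; q]%SET != [set i; j]%SET -> seg_val A p q = seg_val c p q.
    move=> pq nij; apply: eq_seg_val => e eE; apply: eqA; rewrite !inE QT ?eE // andbT.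
    by rewrite -val_eqE /= eE dE.
  have := tA _ _ _ _ cw.
  have [n1 n2 n3 n4] : [/\ [set i; k] != [set i; j], [set k; j] != [set i; j],
      [set j; l] != [set i; j] & [set i; l] != [set i; j]]%SET.
    have [nik nkj njl nil] := clockwise_neq cw; have [_ _ nli nki] := clockwise_neq cw'.
    by split; apply/eqP => /set2_eq [] [e1 e2]; subst;
      rewrite ?eqxx // in nik nkj njl nil nli nki.
  rewrite (eqQ _ _ ik n1) (eqQ _ _ kj n2) (eqQ _ _ jl n3) (eqQ _ _ il n4) => eqc.
  rewrite -eqc in le_c.
  have := leA _ dS; have := leA _ d'S.
  rewrite !(seg_val_diagonal _ dE) !(seg_val_diagonal _ d'E) in le_c => l1 l2.
  apply/rowP => x; rewrite !mxE; have [->|nx] := eqVneq (enum_val x) d.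
    by lra.
  by apply: eqA; rewrite !inE nx enum_valP.
have := nd T T' pT cT (finset.subsetDl _ _).
have dim1 : (n - #|T| = 1)%N.
  have := card_complete_triangulation cT; rewrite (cardsD1 d T') dT' -/T => cardT.
  by rewrite -[X in (X - _)%N]cardT addnK.
rewrite dim1 => -[x0 [V [dimV hull]]].
have hullE y : y - x0 \in V -> y = coordinates T' c.
  move=> yV; have : affine_hull (coordinates T' @` face c T)%classic y by rewrite hull.
  case=> m [a [x [xF a1 ->]]].
  rewrite (eq_bigr (fun t => a t *: coordinates T' c)).
    by rewrite -scaler_suml a1 scale1r.
  by move=> t _; have [A /faceE AE <-] := xF t; rewrite AE.
have [w wV w0] : exists2 w, w \in V & w != 0.
  by exists (vpick V); rewrite ?memv_pick // vpick0 -dimv_eq0 dimV.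
have e1 := hullE x0; have e2 := hullE (x0 + w).
move: e2; rewrite addrAC subrr add0r => /(_ wV); rewrite -e1 ?subrr ?mem0v // => /eqP.
by rewrite -subr_eq0 addrAC subrr add0r (negPf w0).
Qed.

End Stasheff.

(** * Dimension of a set containing the corner of a box *)

Section CoordinateSubspace.
Variables (R : realType) (m : nat).

Lemma coordinate_subspace (P : pred 'I_m) : exists V : {vspace 'rV[R]_m},
  \dim V = #|P| /\ forall v : 'rV[R]_m, v \in V <-> forall i, ~~ P i -> v 0 i = 0.
Proof.
pose X : #|P|.-tuple 'rV[R]_m := [tuple delta_mx 0 (enum_val k) | k < #|P|].
have sumX (a : 'I_#|P| -> R) j :
    (\sum_k a k *: X`_k) 0 j = \sum_k a k * (j == enum_val k)%:R.
  by rewrite summxE; apply: eq_bigr => k _; rewrite nth_mktuple !mxE eqxx.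
exists <<X>>%VS; split.
  suff : free X by rewrite /free size_tuple => /eqP.
  apply/freeP => a a0 k; have := sumX a (enum_val k).
  rewrite a0 mxE (bigD1 k) //= eqxx mulr1 big1 ?addr0 // => t tk.
  by rewrite (inj_eq enum_val_inj) eq_sym (negPf tk) mulr0.
move=> v; split=> [vX j Pj|v0].
  rewrite (coord_span vX) sumX big1 // => k _.
  case: eqP => [jk|_]; last by rewrite mulr0.
  by have := enum_valP k; rewrite -jk unfold_in (negPf Pj).
rewrite (row_sum_delta v); apply: memv_suml => j _.
have [Pj|/v0 ->] := boolP (P j); last by rewrite scale0r mem0v.
apply/memvZ/memv_span/tnthP; exists (enum_rank_in Pj j).
by rewrite tnth_mktuple enum_rankK_in.
Qed.

(** If [X] lies in the affine subspace through [x0] parallel to the coordinates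
    in [P] and contains the box [x0 - eps, x0] of this subspace, then the line
    joining the centre of the box to any point of the subspace meets the box in a
    second point, so that two points of [X] suffice to reach it. *)
Lemma affine_hull_of_corner (x0 : 'rV[R]_m) (P : pred 'I_m) (eps : R)
    (X : set 'rV[R]_m) : 0 < eps ->
  (forall x, X x -> forall i, ~~ P i -> x 0 i = x0 0 i) ->
  (forall x : 'rV[R]_m, (forall i, ~~ P i -> x 0 i = x0 0 i) ->
     (forall i, x0 0 i - eps <= x 0 i <= x0 0 i) -> X x) ->
  has_dimension X #|P|.
Proof.
move=> eps0 Xsub boxX; have [V [dimV VP]] := coordinate_subspace P.
exists x0, V; split=> //; apply/seteqP; split=> y /=.
  case=> k [a [x [xX a1 ->]]]; apply/VP => i Pi; rewrite !mxE summxE.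
  rewrite (eq_bigr (fun t => a t * x0 0 i)); first by rewrite -mulr_suml a1 mul1r subrr.
  by move=> t _; rewrite !mxE (Xsub _ (xX t)).
move=> /VP yV.
(* The centre of the box; the factor t shrinks y - z to half its width. *)
pose z : 'rV[R]_m := \row_i (x0 0 i - (if P i then eps / 2 else 0)).
pose M := 1 + \sum_i `|(y - z) 0 i|.
have M0 : 0 < M by rewrite ltr_pwDl // sumr_ge0.
have leM i : `|(y - z) 0 i| <= M.
  by rewrite /M (bigD1 i) //= addrCA lerDl addr_ge0 // sumr_ge0.
pose t := eps / 2 / M.
have t0 : 0 < t by rewrite !divr_gt0.
have tle i : `|t * (y - z) 0 i| <= eps / 2.
  rewrite normrM (gtr0_norm t0); apply: (le_trans (ler_wpM2l (ltW t0) (leM i))).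
  by rewrite /t divfK // gt_eqF.
pose z' := z + t *: (y - z).
exists 2, (fun i => if i == ord0 then 1 - t^-1 else t^-1).
exists (fun i => if i == ord0 then z else z').
split.
- have xz : X z.
    apply: boxX => i; first by move=> /negPf Pi; rewrite mxE Pi subr0.
    by rewrite mxE; case: (P i); apply/andP; split; lra.
  have xz' : X z'.
    apply: boxX => i.
      move=> Pi; have := yV i Pi; rewrite !mxE (negPf Pi) subr0 => ->.
      by rewrite mulr0 addr0.
    have := tle i; rewrite ler_norml !mxE; case: ifPn => Pi.
      by case/andP => h1 h2; apply/andP; split; lra.
    move=> _; have := yV i Pi; rewrite !mxE subr0 => ->.
    by rewrite mulr0 addr0; apply/andP; split; lra.
  by move=> i; case: ifP.
- by rewrite !big_ord_recl big_ord0 /= addr0 subrK.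
- rewrite !big_ord_recl big_ord0 /= addr0 /z' scalerDr scalerA mulVf ?gt_eqF // scale1r.
  by rewrite addrA -scalerDl subrK scale1r addrC subrK.
Qed.

End CoordinateSubspace.

(** * Strict inequalities give faces of full dimension *)

Section Nondegenerate.
Variables (R : realType) (n : nat).
Implicit Types (i j k l : 'I_n.+3) (d e : gon_diagonal n)
  (T : {set gon_diagonal n}) (c A : gon_diagonal n -> R).

Lemma finite_gap (I : finType) (P : pred I) (F : I -> R) :
  (forall x, P x -> 0 < F x) -> exists2 eps, 0 < eps & forall x, P x -> eps <= F x.
Proof.
move=> F0; exists (\big[Num.min/1]_(x | P x) F x).
  by apply/bigmin_gtP; split=> //; exact: ltr01.
by move=> x Px; apply: bigmin_le_cond.
Qed.

(** Let [eps] be a lower bound for all the gaps. A point whose coordinates on [T']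
    lie within [eps] below [c] satisfies all the other bounds, so the face
    contains a box in the coordinates of [T'] outside [T]. *)
Lemma inequalities_nondegenerate c :
  (forall i k j l, clockwise i k j l ->
     Num.max (seg_val c i k + seg_val c j l) (seg_val c k j + seg_val c i l)
     < seg_val c i j + seg_val c k l) ->
  nondegenerate_polytope c.
Proof.
move=> lt_c T T' pT cT' TT'.
have [eps eps0 gap] : exists2 eps : R, 0 < eps & forall i k j l, clockwise i k j l ->
     Num.max (seg_val c i k + seg_val c j l) (seg_val c k j + seg_val c i l) + eps
     <= seg_val c i j + seg_val c k l.
  have [|eps eps0 epsP] := @finite_gap ('I_n.+3 * 'I_n.+3 * 'I_n.+3 * 'I_n.+3)%type
    (fun x => clockwise x.1.1.1 x.1.1.2 x.1.2 x.2)
    (fun x => seg_val c x.1.1.1 x.1.2 + seg_val c x.1.1.2 x.2 -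
       Num.max (seg_val c x.1.1.1 x.1.1.2 + seg_val c x.1.2 x.2)
               (seg_val c x.1.1.2 x.1.2 + seg_val c x.1.1.1 x.2)).
    by move=> x /lt_c; rewrite subr_gt0.
  by exists eps => // i k j l /(epsP (i, k, j, l)); rewrite lerBrDl.
have pT' : partial_triangulation T' by have /maxsetP [] := cT'.
pose P : pred 'I_#|T'| := fun t => enum_val t \notin T.
have -> : (n - #|T|)%N = #|P|.
  rewrite -[X in (X - _)%N](card_complete_triangulation cT') -cardsDS //.
  rewrite -[RHS](card_imset _ enum_val_inj); apply: eq_card => d.
  apply/setDP/imsetP => [[dT1 dT]|[t Pt ->]].
    by exists (enum_rank_in dT1 d); rewrite ?unfold_in ?enum_rankK_in.
  by split=> //; exact: enum_valP.
apply: (@affine_hull_of_corner _ _ (coordinates T' c) _ eps) => //.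
  move=> x [A [tA eqA leA] <-] i /negPn Pi; rewrite !mxE; exact: eqA.
move=> x xT xbox.
pose y d := \sum_(t | enum_val t == d) x 0 t.
have yE t : y (enum_val t) = x 0 t.
  by rewrite /y (eq_bigl (pred1 t)) ?big_pred1_eq // => t'; rewrite (inj_eq enum_val_inj).
have [A tA AT'] := exists_tropical_point cT' y.
have AE t : A (enum_val t) = x 0 t by rewrite AT' ?yE // enum_valP.
have boxA d : d \in T' -> c d - eps <= A d <= c d.
  move=> dT'; rewrite -(enum_rankK_in dT' dT') AE.
  by have := xbox (enum_rank_in dT' d); rewrite mxE.
have leA : forall d, A d <= c d.
  apply: (@le_seg_val_of_triangulation _ _ eps _ _ T') => //.
  - by move=> d /boxA /andP [].
  - by move=> d /boxA /andP [].
  - by move=> d; rewrite complete_compatible0 // inE.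
exists A; last by apply/rowP => t; rewrite mxE AE.
split=> // d dT; have dT' := fintype.subsetP TT' d dT.
rewrite -(enum_rankK_in dT' dT') AE xT ?mxE //.
by rewrite /P enum_rankK_in // negbK.
Qed.

End Nondegenerate.

Theorem theorem2p7 (R : realType) (n : nat) (hn : (1 <= n)%N)
    (c : gon_diagonal n -> R) :
  (stasheff_polytope c <->
   forall i k j l : 'I_n.+3, clockwise i k j l ->
     seg_val c i j + seg_val c k l >=
     Num.max (seg_val c i k + seg_val c j l) (seg_val c k j + seg_val c i l))
  /\
  (nondegenerate_polytope c <->
   forall i k j l : 'I_n.+3, clockwise i k j l ->
     seg_val c i j + seg_val c k l >
     Num.max (seg_val c i k + seg_val c j l) (seg_val c k j + seg_val c i l)).
Proof.
split; split.
- exact: stasheff_inequalities.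
- exact: inequalities_stasheff.
- exact: nondegenerate_inequalities.
- exact: inequalities_nondegenerate.
Qed.
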